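(* Let $\mathcal{C} \subseteq \mathbb{R}^d$ be a pointed rational polyhedral cone, let $P \subseteq \mathbb{R}^d$ be a $\mathcal{C}$-compatible polytope, let $n \in \mathbb{N}$, let $\alpha$ be a positive integer, and let $\tau$ be a truncated addition table on $n$ elements. Then the map $$(\hat{x}_1, \ldots, \hat{x}_n) \mapsto \{0\} \cup \{\hat{x}_1, \ldots, \hat{x}_n\} \cup \big((\mathcal{C} \setminus \alpha P) \cap \mathbb{Z}^d\big)$$ is a bijection from the set of integer lattice points of $\alpha \mathcal{P}_\tau^{(\mathcal{C},P)}$ to the set of affine semigroups $S \in \mathcal{S}_{\mathcal{C},P}(n,\alpha)$ whose nonzero elements $\hat{x}_1 <_{\mathrm{lex}} \cdots <_{\mathrm{lex}} \hat{x}_n$ in $\alpha P$ have associated addition table $\tau$ in $\alpha P$.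
   Context: $\mathbb{N} = \{0,1,2,\ldots\}$ and $[n] = \{1,\ldots,n\}$. A rational polyhedral cone in $\mathbb{R}^d$ is the set of nonnegative real linear combinations of finitely many integer vectors; it is pointed if the only element whose additive inverse also lies in the cone is $0$. An affine semigroup is the set of nonnegative integer linear combinations of a finite collection of vectors in $\mathbb{Z}^d$. For a pointed rational polyhedral cone $\mathcal{C}$, a $\mathcal{C}$-semigroup is a subset $S \subseteq \mathcal{C} \cap \mathbb{Z}^d$ that contains $0$, is closed under addition, and has finite complement in $\mathcal{C} \cap \mathbb{Z}^d$ (such a set is automatically an affine semigroup). The points of $(\mathcal{C}\cap \mathbb{Z}^d)\setminus S$ are the gaps of $S$. A rational polytope $P \subseteq \mathbb{R}^d$ (convex hull of finitely many rational points) that contains a neighborhood of the origin in $\mathcal{C}$ is $\mathcal{C}$-compatible if for every $x \in \mathcal{C} \setminus P$, the translated cone $x + \mathcal{C}$ is a subset of $\mathcal{C} \setminus P$. For $\alpha > 0$, $\alpha P = \{\alpha x : x \in P\}$, and similarly for dilates of other sets. $\mathcal{S}_{\mathcal{C},P}(n,\alpha)$ denotes the set of $\mathcal{C}$-semigroups $S$ such that $S \cap \alpha P$ contains exactly $n$ nonzero elements and all gaps of $S$ are contained in $\alpha P$. The lexicographic order on $\mathbb{R}^d$: $\hat{u} <_{\mathrm{lex}} \hat{v}$ if $\hat{u} \neq \hat{v}$ and the first nonzero entry of $\hat{v} - \hat{u}$ is positive. A truncated addition table on $n$ elements is a function $\tau : [n]^2 \to [n] \cup \{\infty\}$. For a $\mathcal{C}$-compatible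 polytope $Q$, a $\mathcal{C}$-semigroup $S$ has associated addition table $\tau$ in $Q$ if its nonzero elements $\hat{x}_1 <_{\mathrm{lex}} \cdots <_{\mathrm{lex}} \hat{x}_n$ in $Q$ satisfy $\hat{x}_i + \hat{x}_j = \hat{x}_k$ when $\tau(i,j) = k < \infty$ and $\hat{x}_i + \hat{x}_j \in \mathcal{C} \setminus Q$ when $\tau(i,j) = \infty$. (Here this is used with $Q = \alpha P$.) $\mathcal{P}_\tau^{(\mathcal{C},P)} \subseteq \mathbb{R}^{d \times n}$ is the set of tuples $(\hat{x}_1,\ldots,\hat{x}_n)$ of vectors in $\mathbb{R}^d$ satisfying: (order inequalities) $\hat{x}_1 <_{\mathrm{lex}} \cdots <_{\mathrm{lex}} \hat{x}_n$; (cone inequalities) $\hat{x}_i \in \mathcal{C} \setminus \{0\}$ for all $i$; (polytope inequalities) $\hat{x}_i \in P$ for all $i$; (sporadic relations) $\hat{x}_i + \hat{x}_j = \hat{x}_k$ whenever $\tau(i,j) = k < \infty$; (truncation inequalities) $\hat{x}_i + \hat{x}_j \notin P$ whenever $\tau(i,j) = \infty$. Its integer lattice points are those with all $\hat{x}_i \in \mathbb{Z}^d$. *)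

(* Defs.v *)
From HB Require Import structures.
From mathcomp Require Import all_boot all_order all_algebra.
From mathcomp Require Import all_classical all_reals all_analysis.

Set Implicit Arguments.
Unset Strict Implicit.
Unset Printing Implicit Defensive.

Import Order.TTheory GRing.Theory Num.Theory.
Import numFieldNormedType.Exports.

Local Open Scope classical_set_scope.
Local Open Scope ring_scope.

(* Points of R^d are column vectors; a tuple (x_1, ..., x_n) of points, i.e. an
   element of R^(d x n), is the matrix X whose columns are x_i = col i X. *)

Definition int_points (R : realType) (d n : nat) : set 'M[R]_(d, n) :=
  [set X | X \is a mxOver Num.int].

Definition dilate (R : realType) (V : lmodType R) (a : R) (A : set V) : set V :=
  [set a *: x | x in A].

Definition columns (R : realType) (d n : nat) (X : 'M[R]_(d, n)) :
  set 'cV[R]_d := [set col i X | i in [set: 'I_n]].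

Definition rational_cone (R : realType) (d : nat) (C : set 'cV[R]_d) : Prop :=
  exists (k : nat) (v : 'I_k -> 'cV[int]_d),
    C = [set x | exists2 c : 'I_k -> R, (forall i, 0 <= c i) &
                   x = \sum_(i < k) c i *: map_mx intr (v i)].

Definition pointed (R : realType) (d : nat) (C : set 'cV[R]_d) : Prop :=
  forall x, C x -> C (- x) -> x = 0.

Definition rational_polytope (R : realType) (d : nat) (P : set 'cV[R]_d) :
  Prop :=
  exists (k : nat) (v : 'I_k -> 'cV[rat]_d),
    P = [set x | exists c : 'I_k -> R,
           [/\ forall i, 0 <= c i, \sum_(i < k) c i = 1 &
               x = \sum_(i < k) c i *: map_mx ratr (v i)]].

(* P need not be contained in C. *)
Definition compatible (R : realType) (d : nat) (C P : set 'cV[R]_d) : Prop :=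
  [/\ rational_polytope P,
      within C (nbhs (0 : 'cV[R]_d)) P &
      forall x, (C `\` P) x -> [set x + y | y in C] `<=` C `\` P].

Definition affine_semigroup (R : realType) (d : nat) (S : set 'cV[R]_d) :
  Prop :=
  exists (k : nat) (v : 'I_k -> 'cV[int]_d),
    S = [set \sum_(i < k) map_mx intr (v i) *+ m i | m in [set: 'I_k -> nat]].

Definition gaps (R : realType) (d : nat) (C S : set 'cV[R]_d) :
  set 'cV[R]_d := (C `&` @int_points R d 1) `\` S.

Definition C_semigroup (R : realType) (d : nat) (C S : set 'cV[R]_d) : Prop :=
  [/\ S `<=` C `&` @int_points R d 1, S 0,
      forall x y, S x -> S y -> S (x + y) &
      finite_set (gaps C S)].

(* The set S_{C,P}(n, alpha). *)
Definition C_semigroups_in (R : realType) (d : nat) (C P : set 'cV[R]_d)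
  (n : nat) (alpha : R) : set (set 'cV[R]_d) :=
  [set S | [/\ C_semigroup C S,
               ((S `&` dilate alpha P) `\ 0 #= `I_n)%card &
               gaps C S `<=` dilate alpha P]].

Definition lexlt (R : realType) (d : nat) (u v : 'cV[R]_d) : Prop :=
  exists i : 'I_d,
    (forall j : 'I_d, (j < i)%N -> (v - u) j 0 = 0) /\ 0 < (v - u) i 0.

Definition lex_increasing (R : realType) (d n : nat) (X : 'M[R]_(d, n)) :
  Prop := forall i j : 'I_n, (i < j)%N -> lexlt (col i X) (col j X).

(* The value None stands for infinity. *)
Definition addition_table (n : nat) : Type := 'I_n -> 'I_n -> option 'I_n.

Definition has_addition_table (R : realType) (d n : nat) (C Q : set 'cV[R]_d)
  (tau : addition_table n) (S : set 'cV[R]_d) : Prop :=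
  exists X : 'M[R]_(d, n),
    [/\ (S `&` Q) `\ 0 = columns X,
        lex_increasing X,
        forall i j k, tau i j = Some k -> col i X + col j X = col k X &
        forall i j, tau i j = None -> (C `\` Q) (col i X + col j X)].

(* The set P_tau^{(C,P)}, which is in general neither open nor closed. *)
Definition table_polyhedron (R : realType) (d n : nat) (C P : set 'cV[R]_d)
  (tau : addition_table n) : set 'M[R]_(d, n) :=
  [set X | [/\ lex_increasing X,
               forall i, (C `\ 0) (col i X),
               forall i, P (col i X),
               forall i j k, tau i j = Some k -> col i X + col j X = col k X &
               forall i j, tau i j = None -> ~ P (col i X + col j X)]].

(* Main.v *)
Require Import Defs.
From HB Require Import structures.
From mathcomp Require Import all_boot all_order all_algebra.
From mathcomp Require Import all_classical all_reals all_analysis.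

Import Order.TTheory GRing.Theory Num.Theory.
Import numFieldNormedType.Exports.

Local Open Scope classical_set_scope.
Local Open Scope ring_scope.

(** Every inequality defining the table polyhedron except membership in [P] is
    homogeneous, so dilating the polyhedron amounts to replacing [P] by
    [Q = alpha P] ([dilate_table_polyhedron]); the dilate inherits from [P] the
    property that [C `\` Q] absorbs translation by [C] ([dilate_absorbing]).
    The correspondence is then proved for any bounded [Q] with this property
    ([tuple_semigroup_bij]).

    The set attached to a tuple [X] is closed under addition because a sum of
    two columns is either a column or outside [Q], according to [tau], and any
    sum with a term outside [Q] stays outside [Q]. Its gaps are lattice points
    of the bounded set [Q], so they are finite in number. The tuple is recovered
    from the semigroup: its columns are the nonzero elements of the semigroup
    lying in [Q] ([semigroup_of_tuple_nonzero]), and a set has at most one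
    lexicographically increasing enumeration ([lex_increasing_unique]).
    Conversely, a semigroup all of whose gaps lie in [Q] contains every lattice
    point of [C `\` Q], hence is determined by its elements in [Q].

    The remaining content is that a C-semigroup is finitely generated
    ([C_semigroup_affine]). A suitable multiple of each ray generator of [C]
    lies in the semigroup [S], since only finitely many of the multiples can be
    gaps; so [C] is spanned by vectors [w i] of [S] ([C_semigroup_rays]). An
    element of [S] outside a large enough box has some coefficient at least 1
    along the [w i]; subtracting that [w i] leaves a lattice point of [C] too
    large to be a gap, hence an element of [S]. As the coefficient sum drops by
    1, this descent ends inside the box, and the elements of [S] in the box
    generate [S]. *)

Set Implicit Arguments.
Unset Strict Implicit.
Unset Printing Implicit Defensive.

(** * Lexicographic order and increasing tuples *)

Lemma lexlt_irr (R : realType) (d : nat) (u : 'cV[R]_d) : ~ lexlt u u.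
Proof. by move=> [i [_]]; rewrite subrr mxE ltxx. Qed.

Lemma lexlt_asym (R : realType) (d : nat) (u v : 'cV[R]_d) :
  lexlt u v -> ~ lexlt v u.
Proof.
move=> [i [ltiE ltuv]] [j [ltjE ltvu]].
have sub_swap k : (v - u) k 0 = - (u - v) k 0 by rewrite !mxE opprB.
case: (ltngtP i j) => [/ltjE E|/ltiE E|/val_inj E].
- by move: ltuv; rewrite sub_swap E oppr0 ltxx.
- by move: ltvu; rewrite -[X in 0 < X]opprK -sub_swap E oppr0 ltxx.
- by move: ltuv; rewrite sub_swap E oppr_gt0 ltNge (ltW ltvu).
Qed.

Lemma lexltZ (R : realType) (d : nat) (a : R) (u v : 'cV[R]_d) :
  0 < a -> lexlt u v -> lexlt (a *: u) (a *: v).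
Proof.
move=> a_gt0 [i [ltiE ltuv]]; exists i; rewrite -scalerBr.
split; last by rewrite mxE mulr_gt0.
by move=> j /ltiE E; rewrite mxE E mulr0.
Qed.

Lemma lex_increasing_inj (R : realType) (d n : nat) (X : 'M[R]_(d, n)) :
  lex_increasing X -> injective (fun i => col i X).
Proof.
move=> incX i j /= eq_col; apply/eqP/negPn/negP => neq_ij.
case: (ltngtP i j) => [/incX|/incX|/val_inj E].
- by rewrite eq_col; apply: lexlt_irr.
- by rewrite eq_col; apply: lexlt_irr.
- by rewrite E eqxx in neq_ij.
Qed.

Lemma leq_increasing (n : nat) (f : 'I_n -> 'I_n) :
  (forall i j : 'I_n, (i < j)%N -> (f i < f j)%N) ->
  forall i : 'I_n, (i <= f i)%N.
Proof.
move=> incf; case; elim=> [|m IHm] // ltm.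
exact: leq_ltn_trans (IHm (ltnW ltm))
  (incf (Ordinal (ltnW ltm)) (Ordinal ltm) (leqnn _)).
Qed.

Lemma lex_increasing_reindex (R : realType) (d n : nat) (X Y : 'M[R]_(d, n)) :
  lex_increasing X -> lex_increasing Y -> columns X `<=` columns Y ->
  exists f : 'I_n -> 'I_n,
    (forall i, col i X = col (f i) Y) /\ (forall i : 'I_n, (i <= f i)%N).
Proof.
move=> incX incY subXY.
have /choice[f fE] : forall i, exists j, col i X = col j Y.
  by move=> i; have [|j _ <-] := subXY (col i X); [exists i | exists j].
exists f; split => //; apply: leq_increasing => i j /incX.
rewrite !fE; case: ltngtP => // [/incY lt1 lt2|/val_inj ->].
- by case: (lexlt_asym lt1 lt2).
- by move/lexlt_irr.
Qed.

(** Each tuple is a reindexing of the other by a map that dominates the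
    identity; the two maps are mutually inverse, so both are the identity. *)
Lemma lex_increasing_unique (R : realType) (d n : nat) (X Y : 'M[R]_(d, n)) :
  lex_increasing X -> lex_increasing Y -> columns X = columns Y -> X = Y.
Proof.
move=> incX incY eqXY.
have [|f [fE lef]] := lex_increasing_reindex incX incY.
  by rewrite eqXY.
have [|g [gE leg]] := lex_increasing_reindex incY incX.
  by rewrite eqXY.
have f_id i : f i = i.
  apply/val_inj/eqP; rewrite eqn_leq lef andbT.
  have {2}<- : g (f i) = i.
    by apply: (lex_increasing_inj incX) => /=; rewrite -gE fE.
  exact: leg.
apply/matrixP => i j.
by have /matrixP/(_ i 0) := fE j; rewrite f_id !mxE.
Qed.

Lemma columns_card (R : realType) (d n : nat) (X : 'M[R]_(d, n)) :
  lex_increasing X -> (columns X #= `I_n)%card.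
Proof.
move=> /lex_increasing_inj injX; apply: card_eq_trans (card_esym card_II).
by apply: inj_card_eq => i j _ _; apply: injX.
Qed.

(** * Cones and dilates *)

Lemma coneD (R : realType) (d : nat) (C : set 'cV[R]_d) (x y : 'cV[R]_d) :
  rational_cone C -> C x -> C y -> C (x + y).
Proof.
move=> [k [v ->]] [b b_ge0 ->] [c c_ge0 ->]; exists (fun i => b i + c i).
  by move=> i; rewrite addr_ge0.
by rewrite -big_split; apply: eq_bigr => i _; rewrite scalerDl.
Qed.

Lemma coneZ (R : realType) (d : nat) (C : set 'cV[R]_d) (a : R) (x : 'cV[R]_d) :
  rational_cone C -> 0 <= a -> C x -> C (a *: x).
Proof.
move=> [k [v ->]] a_ge0 [c c_ge0 ->]; exists (fun i => a * c i).
  by move=> i; rewrite mulr_ge0.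
by rewrite scaler_sumr; apply: eq_bigr => i _; rewrite scalerA.
Qed.

Lemma cone0 (R : realType) (d : nat) (C : set 'cV[R]_d) :
  rational_cone C -> C 0.
Proof.
move=> [k [v ->]]; exists (fun=> 0) => //.
by rewrite big1 // => i _; rewrite scale0r.
Qed.

Lemma dilateE (R : realType) (V : lmodType R) (a : R) (A : set V) (x : V) :
  a != 0 -> dilate a A x = A (a^-1 *: x).
Proof.
move=> a_neq0; apply/propext; split => [[y Ay <-]|Ax].
  by rewrite scalerK.
by exists (a^-1 *: x) => //; rewrite scalerKV.
Qed.

Lemma dilate_absorbing (R : realType) (d : nat) (C P : set 'cV[R]_d) (a : R) :
  rational_cone C -> 0 < a ->
  (forall x, (C `\` P) x -> [set x + y | y in C] `<=` C `\` P) ->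
  forall x y, (C `\` dilate a P) x -> C y -> (C `\` dilate a P) (x + y).
Proof.
move=> hC a_gt0 absP x y [Cx]; rewrite dilateE ?gt_eqF// => nPx Cy.
have a'_ge0 : 0 <= a^-1 by rewrite invr_ge0 ltW.
split; first exact: coneD.
rewrite dilateE ?gt_eqF// scalerDr.
have [||//] := absP (a^-1 *: x) _ (a^-1 *: x + a^-1 *: y).
  by split=> //; apply: coneZ.
by exists (a^-1 *: y) => //; apply: coneZ.
Qed.

Lemma table_polyhedronZ (R : realType) (d n : nat) (C P : set 'cV[R]_d)
    (tau : addition_table n) (a : R) (X : 'M[R]_(d, n)) :
  rational_cone C -> 0 < a ->
  table_polyhedron C P tau X ->
  table_polyhedron C (dilate a P) tau (a *: X).
Proof.
move=> hC a_gt0 [incX CX PX relX trX]; have a_neq0 := lt0r_neq0 a_gt0.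
split=> [i j /incX|i|i|i j k /relX E|i j /trX].
- by rewrite !linearZ; apply: lexltZ.
- have [CXi /eqP X_neq0] := CX i; rewrite linearZ; split.
    by apply: coneZ => //; apply: ltW.
  by apply/eqP; rewrite scaler_eq0 negb_or a_neq0.
- by rewrite linearZ dilateE// scalerK//; apply: PX.
- by rewrite !linearZ -scalerDr E.
- by rewrite !linearZ -scalerDr dilateE// scalerK.
Qed.

(** The reverse inclusion is [table_polyhedronZ] for the factor [a^-1]. *)
Lemma dilate_table_polyhedron (R : realType) (d n : nat) (C P : set 'cV[R]_d)
    (tau : addition_table n) (a : R) :
  rational_cone C -> 0 < a ->
  dilate a (table_polyhedron C P tau) = table_polyhedron C (dilate a P) tau.
Proof.
move=> hC a_gt0; apply/seteqP; split=> [_ [X TX <-]|X TX].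
  exact: table_polyhedronZ.
have a_neq0 := lt0r_neq0 a_gt0.
rewrite dilateE//.
have -> : P = dilate a^-1 (dilate a P).
  apply/funext => x; rewrite dilateE ?invr_neq0// dilateE// invrK.
  by rewrite scalerK.
by apply: table_polyhedronZ => //; rewrite invr_gt0.
Qed.

(** * Finiteness of bounded sets of lattice points *)

(** Boundedness is measured coordinatewise, so that the lattice points of a
    bounded set are counted through their integer coordinates. *)
Definition box (R : realType) (d : nat) (B : R) : set 'cV[R]_d :=
  [set x | forall i, `|x i 0| <= B].

Lemma int_points0 (R : realType) (d n : nat) : @int_points R d n 0.
Proof. by apply/mxOverP => i j; rewrite mxE rpred0. Qed.

Lemma int_pointsD (R : realType) (d n : nat) (X Y : 'M[R]_(d, n)) :
  int_points X -> int_points Y -> int_points (X + Y).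
Proof.
move=> /mxOverP Xint /mxOverP Yint; apply/mxOverP => i j.
by rewrite !mxE rpredD.
Qed.

Lemma int_pointsB (R : realType) (d n : nat) (X Y : 'M[R]_(d, n)) :
  int_points X -> int_points Y -> int_points (X - Y).
Proof.
move=> /mxOverP Xint /mxOverP Yint; apply/mxOverP => i j.
by rewrite !mxE rpredB.
Qed.

Lemma int_pointsMn (R : realType) (d n m : nat) (X : 'M[R]_(d, n)) :
  int_points X -> int_points (X *+ m).
Proof.
by move=> /mxOverP Xint; apply/mxOverP => i j; rewrite mulmxnE rpredMn.
Qed.

Lemma finite_box_int_points (R : realType) (d : nat) (B : R) :
  finite_set (@box R d B `&` @int_points R d 1).
Proof.
pose N := Num.bound B.
pose pt (f : {ffun 'I_d -> 'I_(N + N).+1}) : 'cV[R]_d :=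
  \col_i ((f i)%:R - N%:R).
apply: (@sub_finite_set _ _ (pt @` [set: _])); last first.
  exact: finite_image.
move=> x [xB /mxOverP xint].
have /choice[z zE] : forall i, exists z : int, x i 0 = z%:~R.
  by move=> i; have /intrP[z ->] := xint i 0; exists z.
have zN i : (`|z i| <= N)%R.
  rewrite -(ler_int R) intr_norm -zE.
  by apply/ltW/(le_lt_trans (xB i))/archi_boundP/(le_trans _ (xB i)).
have zN0 i : 0 <= z i + N%:Z.
  rewrite -lerBlDr sub0r lerNl; apply: le_trans (zN i).
  by rewrite -normrN ler_norm.
exists [ffun i => inord (absz (z i + N%:Z))] => //.
apply/matrixP => i j; rewrite !mxE ffunE ord1 inordK; last first.
  rewrite ltnS -lez_nat gez0_abs// PoszD lerD2r.
  exact: le_trans (ler_norm _) (zN i).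
by rewrite natr_absz ger0_norm// intrD zE addrK.
Qed.

Lemma polytope_bounded (R : realType) (d : nat) (P : set 'cV[R]_d) :
  rational_polytope P -> exists B, P `<=` box B.
Proof.
move=> [k [v ->]].
exists (\sum_(i < k) \sum_(j < d) `|(map_mx ratr (v i) : 'cV[R]_d) j 0|).
move=> _ [c [c_ge0 c_sum ->]] j; rewrite summxE.
apply: le_trans (ler_norm_sum _ _ _) _; apply: ler_sum => i _.
rewrite mxE normrM ger0_norm//.
have c_le1 : c i <= 1.
  by rewrite -c_sum (bigD1 i)//= lerDl sumr_ge0.
apply: le_trans (ler_piMl (normr_ge0 _) c_le1) _.
by rewrite (bigD1 j)//= lerDl sumr_ge0.
Qed.

Lemma finite_bounded (R : realType) (d : nat) (A : set 'cV[R]_d) :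
  finite_set A -> exists2 B, 0 <= B & A `<=` box B.
Proof.
move=> /finite_seqP[s ->].
exists (\sum_(y <- s) \sum_(j < d) `|y j 0|).
  by apply: sumr_ge0 => y _; apply: sumr_ge0.
move=> x /= xs j; rewrite (big_rem _ xs) (bigD1 j)//= -addrA lerDl.
by rewrite addr_ge0// sumr_ge0// => y _; rewrite sumr_ge0.
Qed.

(** * Finite generation *)

(** The induction principle in the last hypothesis says that [G] generates [S];
    it spares its users the bookkeeping of coefficients. *)
Lemma affine_semigroup_generated (R : realType) (d : nat)
    (S G : set 'cV[R]_d) :
  finite_set G -> G `<=` S -> S `<=` @int_points R d 1 ->
  S 0 -> (forall x y, S x -> S y -> S (x + y)) ->
  (forall T : set 'cV[R]_d,
     T 0 -> (forall x y, G x -> T y -> T (x + y)) -> S `<=` T) ->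
  affine_semigroup S.
Proof.
move=> /finite_seqP[s sE] GS Sint S0 SD Smin.
pose v (i : 'I_(size s)) : 'cV[int]_d := map_mx Num.floor s`_i.
have sS i : S s`_(i : 'I_(size s)).
  by apply: GS; rewrite sE /= mem_nth.
have vE i : map_mx intr (v i) = s`_i.
  apply/matrixP => a b; rewrite !mxE; apply: floorK.
  by have /mxOverP := Sint _ (sS i); apply.
exists (size s), v; apply/seteqP; split.
  apply: Smin => [|x y Gx [m _ <-]].
    by exists (fun=> 0%N) => //; rewrite big1.
  have {Gx} xs : x \in s by rewrite sE in Gx.
  have xi : (index x s < size s)%N by rewrite index_mem.
  exists (fun j => (j == Ordinal xi) + m j)%N => //.
  under eq_bigr do rewrite mulrnDr.
  rewrite big_split; congr (_ + _) => /=.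
  rewrite (bigD1 (Ordinal xi))//= eqxx mulr1n vE nth_index// big1 ?addr0//.
  by move=> j /negPf ->.
move=> _ [m _ <-]; apply: big_ind => // i _; rewrite vE.
by elim: (m i) => [|k IHk]; rewrite ?mulr0n// mulrS; apply: SD.
Qed.

(** The gaps are bounded, whereas a nonzero vector has multiples with
    arbitrarily large coordinates. *)
Lemma multiple_in_C_semigroup (R : realType) (d : nat) (C S : set 'cV[R]_d)
    (x : 'cV[R]_d) :
  rational_cone C -> C_semigroup C S -> C x -> @int_points R d 1 x ->
  exists2 m, (0 < m)%N & S (x *+ m).
Proof.
move=> hC [_ S0 _ /finite_bounded[B B_ge0 gapsB]] Cx xint.
have [->|x_neq0] := eqVneq x 0; first by exists 1%N.
have [j xj_neq0] : exists j, x j 0 != 0.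
  apply/existsP; apply: contraR x_neq0; rewrite negb_exists => /forallP x0.
  by apply/eqP/matrixP => i k; rewrite ord1 mxE; apply/eqP/negPn/x0.
have xj_gt0 : 0 < `|x j 0| by rewrite normr_gt0.
exists (Num.bound (B / `|x j 0|)).
  rewrite -(ltr_nat R); apply: le_lt_trans (archi_boundP _).
    by rewrite divr_ge0.
  by rewrite divr_ge0.
set m := Num.bound _; apply: contrapT => nS.
have /gapsB/(_ j) : gaps C S (x *+ m).
  split=> //; split; last by apply: int_pointsMn.
  by rewrite -scaler_nat; apply: coneZ.
apply/negP; rewrite -ltNge -scaler_nat mxE normrM normr_nat.
by rewrite -ltr_pdivrMr// archi_boundP// divr_ge0.
Qed.

(** Rescaling the generators of a cone by positive factors does not change the
    cone, so they can be chosen inside the semigroup. *)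
Lemma C_semigroup_rays (R : realType) (d : nat) (C S : set 'cV[R]_d) :
  rational_cone C -> C_semigroup C S ->
  exists (k : nat) (w : 'I_k -> 'cV[R]_d),
    (forall i, S (w i)) /\
    C = [set x | exists2 c : 'I_k -> R, (forall i, 0 <= c i) &
                   x = \sum_(i < k) c i *: w i].
Proof.
move=> hC hS; have [k [v vE]] := hC.
have vC i : C (map_mx intr (v i)).
  rewrite vE; exists (fun j => (j == i)%:R) => [j|]; first by rewrite ler0n.
  rewrite (bigD1 i)//= eqxx scale1r big1 ?addr0// => j /negPf ->.
  by rewrite scale0r.
have vint i : @int_points R d 1 (map_mx intr (v i)).
  by apply/mxOverP => a b; rewrite mxE.
have /choice[m mP] : forall i, exists m,
    (0 < m)%N /\ S (map_mx intr (v i) *+ m).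
  move=> i; have [m] := multiple_in_C_semigroup hC hS (vC i) (vint i).
  by exists m.
exists k, (fun i => map_mx intr (v i) *+ m i); split=> [i|].
  by case: (mP i).
rewrite vE; apply/seteqP; split=> _ [c c_ge0 ->].
  exists (fun i => c i / (m i)%:R) => [i|]; first by rewrite divr_ge0.
  apply: eq_bigr => i _.
  rewrite -(scaler_nat (m i) (map_mx _ _)) scalerA divfK//.
  by rewrite pnatr_eq0 -lt0n; case: (mP i).
exists (fun i => c i * (m i)%:R) => [i|]; first by rewrite mulr_ge0.
by apply: eq_bigr => i _; rewrite -(scaler_nat (m i) (map_mx _ _)) scalerA.
Qed.

(** Descent on the coefficient sum along ray generators taken in [S]; it uses
    the finiteness of the gaps in place of Dickson's lemma. *)
Lemma C_semigroup_affine (R : realType) (d : nat) (C S : set 'cV[R]_d) :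
  rational_cone C -> C_semigroup C S -> affine_semigroup S.
Proof.
move=> hC hS; have [k [w [wS CE]]] := C_semigroup_rays hC hS.
have [SC S0 SD /finite_bounded[B0 B0_ge0 gapsB]] := hS.
pose W j := \sum_(i < k) `|w i j 0|.
(* A point outside this box has a coordinate j larger than B0 + W j. Here W j
   bounds the combinations of the [w i] with coefficients below 1, and the extra
   B0 keeps the point out of the gaps after one [w i] is subtracted. *)
pose B := B0 + \sum_(j < d) W j.
have W_ge0 j : 0 <= W j by apply: sumr_ge0.
have wW i j : `|w i j 0| <= W j by rewrite /W (bigD1 i)//= lerDl sumr_ge0.
have WB j : B0 + W j <= B by rewrite lerD2l (bigD1 j)//= lerDl sumr_ge0.
apply: (@affine_semigroup_generated _ _ _ (S `&` box B)) => //.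
- apply: sub_finite_set (@finite_box_int_points _ _ B) => x [Sx Bx].
  by split=> //; case: (SC _ Sx).
- by move=> x /SC[].
move=> T T0 TD x Sx; have [c c_ge0 xE] : exists2 c : 'I_k -> R,
    (forall i, 0 <= c i) & x = \sum_(i < k) c i *: w i.
  by have [] := SC _ Sx; rewrite {1}CE.
have [N] : exists N, \sum_(i < k) c i < N%:R.
  by exists (Num.bound (\sum_(i < k) c i)); apply/archi_boundP/sumr_ge0.
elim: N x c Sx c_ge0 xE => [|N IHN] x c Sx c_ge0 xE cN.
  by move: cN; rewrite ltNge sumr_ge0.
have [Bx|/existsNP[j /negP]] := pselect (box B x).
  by rewrite -[x]addr0; apply: TD.
rewrite -ltNge => Bxj.
have [i ci_ge1] : exists i, 1 <= c i.
  apply/existsP; apply: contraLR Bxj; rewrite negb_exists => /forallP c_lt1.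
  rewrite -leNgt xE summxE; apply: le_trans (WB j); apply: ler_wpDl => //.
  apply: le_trans (ler_norm_sum _ _ _) _; apply: ler_sum => i _.
  by rewrite mxE normrM ger0_norm// ler_piMl// ltW// ltNge c_lt1.
pose c' l := c l - (l == i)%:R.
have c'_ge0 l : 0 <= c' l.
  by rewrite /c'; case: eqVneq => [->|_]; rewrite ?subr0// subr_ge0.
have x'E : x - w i = \sum_(l < k) c' l *: w l.
  under eq_bigr do rewrite scalerBl.
  rewrite sumrB -xE [in RHS](bigD1 i)//= eqxx scale1r big1 ?addr0//.
  by move=> l /negPf ->; rewrite scale0r.
have x'S : S (x - w i).
  apply: contrapT => nS; have /gapsB/(_ j) : gaps C S (x - w i).
    split=> //; split; first by rewrite CE; exists c'.
    by apply: int_pointsB; [case: (SC _ Sx)|case: (SC _ (wS i))].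
  apply/negP; rewrite -ltNge -(ltrD2r (W j)).
  apply: le_lt_trans (WB j) (lt_le_trans Bxj _).
  have -> : x j 0 = (x - w i) j 0 + w i j 0 by rewrite !mxE subrK.
  by apply: le_trans (ler_normD _ _) _; rewrite lerD2l.
rewrite -[x](subrK (w i)) addrC; apply: TD.
  split=> // l; apply: le_trans (wW i l) (le_trans _ (WB l)).
  by rewrite lerDr.
apply: (IHN _ c') => //.
rewrite sumrB ltrBlDr (lt_le_trans cN)//.
by rewrite -natr1 lerD2l (bigD1 i)//= eqxx lerDl sumr_ge0.
Qed.

(** * The bijection *)

Definition semigroup_of_tuple (R : realType) (d n : nat) (C Q : set 'cV[R]_d)
    (X : 'M[R]_(d, n)) : set 'cV[R]_d :=
  [set 0] `|` columns X `|` ((C `\` Q) `&` @int_points R d 1).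

Lemma col_int_points (R : realType) (d n : nat) (X : 'M[R]_(d, n)) :
  @int_points R d n X <-> forall i, @int_points R d 1 (col i X).
Proof.
split=> [/mxOverP Xint i|Xint]; apply/mxOverP => a b; first by rewrite mxE.
by have /mxOverP/(_ a 0) := Xint b; rewrite mxE.
Qed.

Lemma semigroup_of_tuple_nonzero (R : realType) (d n : nat)
    (C Q : set 'cV[R]_d) (X : 'M[R]_(d, n)) :
  (forall i, (C `\ 0) (col i X)) -> (forall i, Q (col i X)) ->
  (semigroup_of_tuple C Q X `&` Q) `\ 0 = columns X.
Proof.
move=> CX QX; apply/seteqP; split=> [x [[[[x0|//]|[[_ nQ] _]] Qx] x_neq0]|].
- by case: x_neq0.
- by case: nQ.
by move=> _ [i _ <-]; split; [split=> //; left; right; exists i|case: (CX i)].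
Qed.

(** This is where the truncation inequalities and the sporadic relations combine
    with the absorbing property: no sum can land on a missing point of [Q]. *)
Lemma semigroup_of_tuple_closed (R : realType) (d n : nat)
    (C Q : set 'cV[R]_d) (tau : addition_table n) (X : 'M[R]_(d, n)) :
  rational_cone C ->
  (forall x y, (C `\` Q) x -> C y -> (C `\` Q) (x + y)) ->
  table_polyhedron C Q tau X -> @int_points R d n X ->
  forall x y, semigroup_of_tuple C Q X x ->
    semigroup_of_tuple C Q X y -> semigroup_of_tuple C Q X (x + y).
Proof.
move=> hC absQ [_ CX _ relX trX] /col_int_points Xint x y.
case=> [[->|[i _ <-]]|[CQx xint]]; first by rewrite add0r.
  case=> [[->|[j _ <-]]|[CQy yint]].
  - by rewrite addr0; left; right; exists i.
  - case E : (tau i j) => [k|].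
      by left; right; exists k; rewrite ?(relX _ _ _ E).
    right; split; last exact: int_pointsD.
    by split; [case: (CX i) (CX j) => Ci _ [Cj _]; apply: coneD | apply: trX].
  - right; split; last exact: int_pointsD.
    by rewrite addrC; apply: absQ => //; case: (CX i).
move=> Sy; right.
have [Cy yint] : C y /\ @int_points R d 1 y.
  case: Sy => [[->|[j _ <-]]|[[]]] //.
    by split; [apply: cone0 | apply: int_points0].
  by split; [case: (CX j) | apply: Xint].
by split; [apply: absQ | apply: int_pointsD].
Qed.

(** Everything that the table records, namely the columns and their sums, is
    visible inside [Q]; the gap condition fixes the semigroup outside [Q]. *)
Lemma tuple_semigroup_bij (R : realType) (d n : nat) (C Q : set 'cV[R]_d)
    (B : R) (tau : addition_table n) :
  rational_cone C -> Q `<=` box B ->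
  (forall x y, (C `\` Q) x -> C y -> (C `\` Q) (x + y)) ->
  set_bij
    (table_polyhedron C Q tau `&` @int_points R d n)
    [set S | [/\ affine_semigroup S,
                 [/\ C_semigroup C S, ((S `&` Q) `\ 0 #= `I_n)%card &
                     gaps C S `<=` Q] &
                 has_addition_table C Q tau S]]
    (semigroup_of_tuple C Q).
Proof.
move=> hC QB absQ; split.
- move=> X [TX Xint]; have [incX CX QX relX trX] := TX.
  set S := semigroup_of_tuple C Q X.
  have SE : (S `&` Q) `\ 0 = columns X by apply: semigroup_of_tuple_nonzero.
  have SgapsQ : gaps C S `<=` Q.
    by move=> x [[Cx xint] nSx]; apply: contrapT => nQx; apply: nSx; right.
  have hS : C_semigroup C S.
    split.
    + move=> x [[->|[i _ <-]]|[[]]] //.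
        by split; [apply: cone0 | apply: int_points0].
      by split; [case: (CX i) | move/col_int_points: Xint; apply].
    + by left; left.
    + exact: semigroup_of_tuple_closed TX Xint.
    + apply: sub_finite_set (@finite_box_int_points _ _ B) => x gx.
      by split; [apply/QB/SgapsQ | case: gx => [[]]].
  split; first exact: C_semigroup_affine hS.
    by split=> //; rewrite SE; apply: columns_card.
  exists X; split=> // i j /trX nQ; split=> //.
  by case: (CX i) (CX j) => Ci _ [Cj _]; apply: coneD.
- move=> X Y; rewrite !inE => -[[incX CX QX _ _] _] [[incY CY QY _ _] _] eqS.
  apply: lex_increasing_unique => //.
  rewrite -(semigroup_of_tuple_nonzero CX QX) eqS.
  exact: semigroup_of_tuple_nonzero.
- move=> S [_ [[SC S0 _ _] _ SgapsQ] [X [SE incX relX trX]]].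
  have SX i : ((S `&` Q) `\ 0) (col i X) by rewrite SE; exists i.
  exists X.
    split; last first.
      by apply/col_int_points => i; have [[/SC[]]] := SX i.
    split=> //.
    + by move=> i; have [[/SC[]]] := SX i.
    + by move=> i; have [[]] := SX i.
    + by move=> i j /trX[].
  apply/seteqP; split=> [x [[->|]|[[Cx nQx] xint]]|x Sx] //.
  + by rewrite -SE => -[[]].
  + by apply: contrapT => nSx; apply/nQx/SgapsQ.
  have [Qx|nQx] := pselect (Q x); last by right; case: (SC _ Sx).
  left; have [->|/eqP x_neq0] := eqVneq x 0; first by left.
  by right; rewrite -SE.
Qed.

Lemma dilate_box (R : realType) (d : nat) (P : set 'cV[R]_d) (a B : R) :
  0 < a -> P `<=` box B -> dilate a P `<=` box (a * B).
Proof.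
move=> a_gt0 PB _ [x /PB xB <-] i.
by rewrite mxE normrM gtr0_norm// ler_pM2l.
Qed.

Theorem theorem3 (R : realType) (d : nat) (C P : set 'cV[R]_d)
  (hC : rational_cone C) (hCp : pointed C) (hP : compatible C P)
  (n alpha : nat) (halpha : (0 < alpha)%N) (tau : addition_table n) :
  set_bij
    (dilate alpha%:R (table_polyhedron C P tau) `&` @int_points R d n)
    [set S | [/\ affine_semigroup S,
                 C_semigroups_in C P n alpha%:R S &
                 has_addition_table C (dilate alpha%:R P) tau S]]
    (fun X : 'M[R]_(d, n) =>
       [set 0] `|` columns X `|`
       ((C `\` dilate alpha%:R P) `&` @int_points R d 1)).
Proof.
have a_gt0 : 0 < alpha%:R :> R by rewrite ltr0n.
have [/polytope_bounded[B PB] _ absP] := hP.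
rewrite dilate_table_polyhedron//.
apply: (@tuple_semigroup_bij _ _ _ _ _ (alpha%:R * B)) => //.
  exact: dilate_box.
exact: dilate_absorbing.
Qed.
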